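(* The Petersen–Salama entropy and the Ban–Chang entropy of the Jacaranda tree $\mathfrak{J}$ are both equal to zero: $$h_{PS}:=\limsup_{n\to+\infty}\frac{1}{2^n}\log\kappa_n=0,\qquad h_{BC}:=\limsup_{n\to+\infty}\frac1n\log\log\kappa_n=0,$$ where $\kappa_n$ is the number of patches of size $n$ appearing in $\mathfrak{J}$.
   Context: $\mathbb{F}_2^+$ is the free monoid on two generators $a,b$ (finite words in $a,b$), with empty word $e$; $|\omega|$ is the length of $\omega$. A tree is an element $\mathfrak{A}=(\mathfrak{A}_\omega)_{\omega\in\mathbb{F}_2^+}$ of $\{0,1\}^{\mathbb{F}_2^+}$ (the root is the site $e$, and the left and right followers of the site $\omega$ are $\omega a$ and $\omega b$). For $\omega\in\mathbb{F}_2^+$, $T_\omega(\mathfrak{A})$ is the subtree of $\mathfrak{A}$ rooted at $\omega$: $(T_\omega(\mathfrak{A}))_\psi=\mathfrak{A}_{\omega\psi}$. The map $H$ (substreetution with grammar BBAB) on trees is defined by: $H(\mathfrak{A})_e=\mathfrak{A}_e$, $H(\mathfrak{A})_a=1$, $H(\mathfrak{A})_b=0$, $T_{aa}(H(\mathfrak{A}))=H(T_b(\mathfrak{A}))$, $T_{ab}(H(\mathfrak{A}))=H(T_b(\mathfrak{A}))$, $T_{ba}(H(\mathfrak{A}))=H(T_a(\mathfrak{A}))$, $T_{bb}(H(\mathfrak{A}))=H(T_b(\mathfrak{A}))$. The Jacaranda tree $\mathfrak{J}$ is the unique tree with root $\mathfrak{J}_e=0$ and $H(\mathfrak{J})=\mathfrak{J}$.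 For $n\ge1$, a patch of size (or length) $n$ is a finite binary tree with $n$ lines that appears in $\mathfrak{J}$, i.e. a map $\{\psi\in\mathbb{F}_2^+:|\psi|\le n-1\}\to\{0,1\}$ of the form $\psi\mapsto\mathfrak{J}_{\omega\psi}$ for some $\omega\in\mathbb{F}_2^+$. $K_n$ is the set of patches of size $n$ and $\kappa_n$ is its cardinality. *)

(* Defs.v *)
From HB Require Import structures.
From mathcomp Require Import all_boot all_order all_algebra.
From mathcomp Require Import all_classical all_reals all_analysis.

Set Implicit Arguments.
Unset Strict Implicit.
Unset Printing Implicit Defensive.

Import Order.TTheory GRing.Theory Num.Theory.

Local Open Scope ring_scope.

Inductive letter := La | Lb.

Definition bool_of_letter (x : letter) : bool := if x is La then false else true.
Definition letter_of_bool (b : bool) : letter := if b then Lb else La.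

Lemma bool_of_letterK : cancel bool_of_letter letter_of_bool.
Proof. by case. Qed.

HB.instance Definition _ := Finite.copy letter (can_type bool_of_letterK).

(* The free monoid on a, b, with concatenation [++] and unit [[::]]. *)
Definition word := seq letter.

(* The labels 0 and 1 are encoded as [false] and [true]. *)
Definition tree := word -> bool.

Definition subtree (w : word) (A : tree) : tree := fun psi => A (w ++ psi).

(* The grammar BBAB lists which of T_a(A), T_b(A) is used below the sites
   aa, ab, ba, bb, in this order. *)
Fixpoint BBAB (A : tree) (w : word) {struct w} : bool :=
  match w with
  | [::]             => A [::]
  | [:: La]          => true
  | [:: Lb]          => false
  | [:: La, La & w'] => BBAB (subtree [:: Lb] A) w'
  | [:: La, Lb & w'] => BBAB (subtree [:: Lb] A) w'
  | [:: Lb, La & w'] => BBAB (subtree [:: La] A) w'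
  | [:: Lb, Lb & w'] => BBAB (subtree [:: Lb] A) w'
  end.

(* Existence and uniqueness of such a tree are [is_jacaranda_ex] and
   [is_jacaranda_uniq] below. *)
Definition is_jacaranda (J : tree) : Prop := J [::] = false /\ BBAB J = J.

(* Binary trees with [n] lines, [1 <= n]: the sites are the words of length
   at most [n.-1].  The case [n = 0] is a dummy value. *)
Definition patch (n : nat) := {ffun n.-1.-bseq letter -> bool}.

Definition patch_at (J : tree) (n : nat) (w : word) : patch n :=
  [ffun psi : n.-1.-bseq letter => J (w ++ psi)].

Definition patches (J : tree) (n : nat) : {set patch n} :=
  [set p : patch n | `[< exists w : word, p = patch_at J n w >]].

Definition kappa (J : tree) (n : nat) : nat := #|patches J n|.

(* The limits superior are taken in the extended reals; the value of the
   sequences at the index 0 is irrelevant. *)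
Definition h_PS (R : realType) (J : tree) : \bar R :=
  limn_esup (fun n : nat => (1 / 2 ^+ n * ln (kappa J n)%:R)%:E).

Definition h_BC (R : realType) (J : tree) : \bar R :=
  limn_esup (fun n : nat => (1 / n%:R * ln (ln (kappa J n)%:R))%:E).

Lemma BBAB_local n (A B : tree) :
  (forall w, (size w <= n)%N -> A w = B w) ->
  forall w, (size w <= n.+1)%N -> BBAB A w = BBAB B w.
Proof.
elim: n A B => [|n IHn] A B AB [|x [|y w]] //=.
- by move=> _; exact: AB.
- by move=> _; exact: AB.
- rewrite !ltnS => sw.
  by case: x; case: y; apply: IHn => [v sv|]; rewrite ?leqW// /subtree AB.
Qed.

Lemma is_jacaranda_uniq (A B : tree) :
  is_jacaranda A -> is_jacaranda B -> A = B.
Proof.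
move=> [A0 HA] [B0 HB].
have AB n w : (size w <= n)%N -> A w = B w.
  elim: n w => [|n IHn] w; first by case: w => //= _; rewrite A0 B0.
  by rewrite -HA -HB; apply: BBAB_local.
by apply/funext => w; exact: (AB (size w)).
Qed.

Lemma is_jacaranda_ex : exists J : tree, is_jacaranda J.
Proof.
pose D n : tree := iter n BBAB (fun=> false).
have DS n w : (size w <= n)%N -> D n.+1 w = D n w.
  elim: n w => [|n IHn] w; first by case: w.
  by apply: BBAB_local.
have DE k w : D (size w + k)%N w = D (size w) w.
  by elim: k => [|k IHk]; rewrite ?addn0// addnS DS ?leq_addr.
exists (fun w => D (size w) w); split=> //; apply/funext => w.
rewrite -[RHS]DS//=; apply: (@BBAB_local (size w)) => //= v sv.
by rewrite -[in RHS](subnKC sv) DE.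
Qed.

(* Main.v *)
Require Import Defs.
From mathcomp Require Import all_boot all_order all_algebra.
From mathcomp Require Import all_classical all_reals all_analysis.
From mathcomp Require Import zify.

(** Let [halve] be the map that cuts a word of even length into blocks of two
    letters and replaces the block [ba] by [a] and the blocks [aa], [ab], [bb]
    by [b].  Unfolding [BBAB J = J] gives a formula for the label of a site [w]
    of the Jacaranda tree ([jacaranda_labelE]): if [w] has odd length the label
    says whether the last letter is [a], and if [w] has even length the label is
    that of the site [halve w], which is half as deep.

    Hence a patch with at most [2 * m] lines rooted at a site [u] of even length
    is determined by the patch with [m.+1] lines rooted at [halve u].  A root of
    odd length is [rcons u x] with [u] of even length, and the patch is then
    determined by the letter [x] and the same patch at [halve u].  Therefore
    [kappa n <= 3 * kappa m.+1] as soon as [n <= 2 * m] ([kappa_double]).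
    Iterating this inequality shows that [kappa n] grows at most exponentially
    in [n] ([kappa_exp_bound]; the true growth is even polynomial), so that
    [ln (kappa n) <= c * n] for some constant [c].

    This linear bound is negligible against [2 ^ n], and its logarithm is
    negligible against [n], so both sequences converge to [0] and so do their
    limits superior. *)

Set Implicit Arguments.
Unset Strict Implicit.
Unset Printing Implicit Defensive.

Import Order.TTheory GRing.Theory Num.Theory.
Import numFieldNormedType.Exports.

(** The substitution of blocks dual to the grammar: below the site [xy], the
    tree [BBAB A] uses the subtree of [A] at the letter [block x y]. *)
Definition block (x y : letter) : letter :=
  match x, y with Lb, La => La | _, _ => Lb end.

(** Blockwise image of a word; a last letter without partner is dropped. *)
Fixpoint halve (w : word) : word :=
  if w is x :: y :: w' then block x y :: halve w' else [::].

Lemma size_halve w : size (halve w) = (size w)./2.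
Proof.
have [n] := ubnP (size w); elim: n w => // n IHn [|x [|y w]] //= sw.
by rewrite IHn //; lia.
Qed.

Lemma halve_cat u v : ~~ odd (size u) -> halve (u ++ v) = halve u ++ halve v.
Proof.
have [n] := ubnP (size u); elim: n u => // n IHn [|x [|y u]] //= su eu.
by rewrite IHn //; lia.
Qed.

(** Closed form of the recursion defining [BBAB], two letters at a time. *)
Lemma BBABE (A : tree) w :
  BBAB A w = if odd (size w) then last Lb w == La else A (halve w).
Proof.
have [n] := ubnP (size w); elim: n w A => // n IHn [|x [|y w]] A //= sw.
  by case: x {sw}.
have sw' : size w < n by lia.
(* The default letter of [last] is irrelevant, since [w] is nonempty when its
   length is odd. *)
by rewrite negbK; case: x; case: y; rewrite IHn //; case: w {sw sw'}.
Qed.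

Lemma jacaranda_labelE (J : tree) w : is_jacaranda J ->
  J w = if odd (size w) then last Lb w == La else J (halve w).
Proof. by move=> [_ HJ]; rewrite -[in LHS]HJ BBABE. Qed.

(** The patch with [n] lines rebuilt from a patch with [m.+1] lines; [o] is the
    last letter of the root if the root has odd length, and [None] otherwise. *)
Definition unfold_patch (n m : nat)
    (q : option letter * Defs.patch m.+1) : Defs.patch n :=
  [ffun psi : n.-1.-bseq letter =>
     let w := seq_of_opt q.1 ++ psi in
     if odd (size w) then last Lb w == La else q.2 (insub_bseq m (halve w))].

(** Every root is of the form [u ++ seq_of_opt o] with [u] of even length. *)
Lemma patch_at_unfold (J : tree) n m u o : is_jacaranda J ->
    n <= m.*2 -> ~~ odd (size u) ->
  patch_at J n (u ++ seq_of_opt o) =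
  unfold_patch n (o, patch_at J m.+1 (halve u)).
Proof.
move=> hJ nm eu; apply/ffunP => psi; rewrite !ffunE -catA jacaranda_labelE //=.
set w := _ ++ psi; rewrite size_cat oddD (negbTE eu) /=.
case: ifP => [|_]; first by rewrite last_cat; case: (w).
have sw : size (halve w) <= m.
  have := size_bseq psi; rewrite size_halve size_cat.
  by case: (o) => /= [_|]; lia.
by rewrite halve_cat // ffunE /insub_bseq insubdK.
Qed.

(** The factor [3] counts the values of the [option letter] that, together with
    a patch with [m.+1] lines, determines a patch with [n] lines. *)
Lemma kappa_double (J : tree) n m : is_jacaranda J ->
  n <= m.*2 -> kappa J n <= 3 * kappa J m.+1.
Proof.
move=> hJ nm.
pose D := finset.setX [set: option letter] (patches J m.+1).
have -> : 3 * kappa J m.+1 = #|D|.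
  rewrite /D cardsX cardsT card_option /kappa.
  suff -> : #|{: letter}| = 2 by [].
  rewrite -card_bool; apply: (@bij_eq_card _ _ bool_of_letter).
  by exists letter_of_bool; case.
apply: leq_trans (leq_imset_card (@unfold_patch n m) D).
apply/subset_leq_card/fintype.subsetP => p.
rewrite inE => /asboolP [w ->].
have [u [l [-> eu]]] : exists u l, w = u ++ seq_of_opt l /\ ~~ odd (size u).
  case ew: (odd (size w)); last first.
    by exists w, None; rewrite cats0 ew.
  case/lastP: w ew => // u x; rewrite size_rcons /= => eu.
  by exists u, (Some x); rewrite cats1 eu.
apply/finset.imsetP; exists (l, patch_at J m.+1 (halve u)).
  by rewrite !inE; exists (halve u).
exact: patch_at_unfold.
Qed.

Lemma kappa_exp_bound (J : tree) : is_jacaranda J ->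
  exists2 C, 0 < C & forall n, 0 < n -> kappa J n <= C ^ n.
Proof.
(* With [m := uphalf n], the recursion lowers the size as soon as [5 <= n]; the
   constant absorbs the sizes at most [4], for which [m = 2] is allowed, and
   the factor [3] of each step. *)
move=> hJ; exists (3 * kappa J 3).+3 => // n.
set C := _.+3.
have [k] := ubnP n; elim: k n => // k IHk n nk n0.
have [n4|n4] := leqP n 4.
  apply: leq_trans (@kappa_double J n 2 hJ n4) _.
  by apply: leq_trans (_ : C <= _); [rewrite /C; lia|rewrite -{1}[C]expn1 leq_pexp2l].
have nm : n <= (uphalf n).*2 by lia.
apply: leq_trans (kappa_double hJ nm) _.
apply: leq_trans (_ : C * C ^ (uphalf n).+1 <= _).
  by rewrite leq_mul // IHk //; lia.
by rewrite -expnS leq_pexp2l //; lia.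
Qed.

Local Open Scope classical_set_scope.
Local Open Scope ring_scope.

Lemma ln_kappa_linear_bound (R : realType) (J : tree) : is_jacaranda J ->
  exists2 c : R, 1 <= c &
    forall n, (0 < n)%N -> ln (kappa J n)%:R <= c * n%:R.
Proof.
move=> /kappa_exp_bound [C C0 kC]; exists (1 + ln C%:R).
  by rewrite lerDl ln_ge0 // ler1n.
move=> n n0; have [k0|k0] := posnP (kappa J n).
  by rewrite k0 ln0 // mulr_ge0 // addr_ge0 // ln_ge0 // ler1n.
apply: (@le_trans _ _ (ln (C%:R ^+ n))).
  by rewrite ler_ln ?posrE ?exprn_gt0 ?ltr0n // -natrX ler_nat kC.
by rewrite lnXn ?ltr0n // -[leLHS]mulr_natr ler_wpM2r // lerDr.
Qed.

Lemma cvg_natV0 (R : realType) : (n%:R^-1 : R) @[n --> \oo] --> (0 : R).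
Proof. by rewrite -cvg_shiftS; exact: cvg_harmonic. Qed.

Lemma sqrn_le_expn2 n : (n * n <= 4 * 2 ^ n)%N.
Proof.
elim: n => // n IHn; rewrite expnS.
by have := ltn_expl n (isT : (1 < 2)%N); lia.
Qed.

(** Any bound negligible against [x] would do. *)
Lemma ln_le_sqrt (R : realType) (x : R) : 0 < x -> ln x <= 2 * Num.sqrt x.
Proof.
move=> x0; rewrite -[in leLHS](sqr_sqrtr (ltW x0)) lnXn ?sqrtr_gt0 //.
by rewrite mulr_natl lerMn2r /= ltW // ln_sublinear // sqrtr_gt0.
Qed.

Lemma ln_ln_nat_bounds (R : realType) (k : nat) (y : R) :
  1 <= y -> ln k%:R <= y -> ln (ln 2 : R) <= ln (ln k%:R) <= ln y.
Proof.
move=> y1 ky.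
have ln2_gt0 : 0 < ln (2 : R) by rewrite ln_gt0 // ltr1n.
have y0 : 0 < y by exact: lt_le_trans y1.
have [k1|k2] := leqP k 1.
  (* Here [ln k%:R = 0], whose logarithm is [0] by convention. *)
  have -> : ln (ln (k%:R : R)) = 0 by rewrite ln0 // ln_le0 // lern1.
  rewrite (ln_ge0 y1) andbT.
  by rewrite -ler_expR lnK ?posrE // expR0 (le_trans (le_ln1Dx _)).
have k0 : 0 < ln (k%:R : R) by rewrite ln_gt0 // ltr1n.
by rewrite !ler_ln ?posrE ?ltr0n ?ky ?ler_nat ?k2 // ltnW.
Qed.

Lemma h_PS_jacaranda (R : realType) (J : tree) :
  is_jacaranda J -> h_PS R J = 0%E.
Proof.
move=> /(ln_kappa_linear_bound R) [c c1 kc].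
apply: (cvg_limn_einf_sup _).2; apply: cvg_EFin; first exact: nearW.
(* The upper bound comes from [n ^ 2 / 4 <= 2 ^ n]. *)
apply: (@squeeze_cvgr _ _ _ _ (cst 0) (fun n => 4 * c * n%:R^-1)).
- near=> n; have n0 : (0 < n)%N by near: n; exact: nbhs_infty_gt.
  have p0 : 0 < 2 ^+ n :> R by rewrite exprn_gt0.
  have n0R : 0 < n%:R :> R by rewrite ltr0n.
  apply/andP; split=> /=.
    have [->|k0] := posnP (kappa J n); first by rewrite ln0 // mulr0.
    by rewrite mulr_ge0 ?ln_ge0 ?ler1n // divr_ge0 // ltW.
  rewrite div1r ler_pdivrMl // mulrA ler_pdivlMr //.
  apply: (@le_trans _ _ (c * n%:R * n%:R)); first by rewrite ler_wpM2r ?kc.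
  rewrite mulrC mulrCA [leRHS]mulrC -!mulrA [leRHS]mulrCA.
  rewrite ler_wpM2l ?(le_trans _ c1) //.
  by rewrite -natrX -!natrM ler_nat sqrn_le_expn2.
- exact: cvg_cst.
- rewrite -[X in _ --> X](mulr0 (4 * c)).
  by apply: cvgMl_tmp; exact: cvg_natV0.
Unshelve. all: by end_near. Qed.

Lemma h_BC_jacaranda (R : realType) (J : tree) :
  is_jacaranda J -> h_BC R J = 0%E.
Proof.
move=> /(ln_kappa_linear_bound R) [c c1 kc].
have c0 : 0 <= c by exact: le_trans c1.
apply: (cvg_limn_einf_sup _).2; apply: cvg_EFin; first exact: nearW.
(* The upper bound comes from [ln (c * n) <= 2 * sqrt (c * n)].  The lower bound
   is negative: [ln (ln 2)] is the least possible value of [ln (ln k)]. *)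
apply: (@squeeze_cvgr _ _ _ _ (fun n => ln (ln 2) * n%:R^-1)
                             (fun n => 2 * Num.sqrt c * Num.sqrt n%:R^-1)).
- near=> n; have n0 : (0 < n)%N by near: n; exact: nbhs_infty_gt.
  have n0R : 0 < n%:R :> R by rewrite ltr0n.
  have cn1 : 1 <= c * n%:R by rewrite mulr_ege1 // ler1n.
  have /andP[lo hi] := ln_ln_nat_bounds cn1 (kc n n0).
  rewrite /= div1r [X in _ <= X <= _]mulrC ler_wpM2r ?invr_ge0 //=.
  rewrite ler_pdivrMr // (le_trans hi) //.
  rewrite (le_trans (ln_le_sqrt _)) ?(lt_le_trans _ cn1) //.
  rewrite sqrtrM // -!mulrA ler_wpM2l // ler_wpM2l ?sqrtr_ge0 //.
  rewrite -[X in _ * X](sqr_sqrtr (ltW n0R)) sqrtrV //.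
  by rewrite expr2 mulKf // gt_eqF // sqrtr_gt0.
- rewrite -[X in _ --> X](mulr0 (ln (ln 2))).
  by apply: cvgMl_tmp; exact: cvg_natV0.
- rewrite (_ : (0 : R) = 2 * Num.sqrt c * Num.sqrt 0); last first.
    by rewrite sqrtr0 mulr0.
  apply: cvgMl_tmp; apply: continuous_cvg; first exact: sqrt_continuous.
  exact: cvg_natV0.
Unshelve. all: by end_near. Qed.

Theorem corollary3 (R : realType) (J : tree) (hJ : is_jacaranda J) :
  h_PS R J = 0%E /\ h_BC R J = 0%E.
Proof. by split; [exact: h_PS_jacaranda|exact: h_BC_jacaranda]. Qed.
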